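(* Let $\Gamma=\{1,\dots,m\}$, let $f_\gamma:\mathbb{R}^n\to\mathbb{R}^n$ ($\gamma\in\Gamma$) be continuous, write $f(\xi,\gamma)=f_\gamma(\xi)$, and consider the switched system $\dot x=f(x,\sigma)$. Assume that $\chi$ is a closed covering of $\mathbb{R}^n$. Then $\mathcal{T}[\chi]\cap\mathcal{T}_a[\tau_D,N_0]$ has the SC property for all $\tau_D>0$ and all $N_0\in\mathbb{N}$.
   Context: Notation: $\mathbb{R}_+=[0,\infty)$, $\mathbb{N}$ is the set of positive integers. Switched system. $\Gamma$ carries the discrete metric. A switching signal is a piecewise constant, right-continuous function $\sigma:\mathbb{R}_+\to\Gamma$. Its switching times are $t_0=0$ and its consecutive discontinuities $t_1<t_2<\cdots$ (finitely many, or infinitely many tending to $\infty$). A solution of $\dot x=f(x,\sigma)$ corresponding to $\sigma$ is a (continuous) piecewise smooth curve $x:\mathcal{I}\to\mathbb{R}^n$, $\mathcal{I}=[0,T)$ or $[0,T]$, $0<T\le\infty$, with $\dot x(t)=f(x(t),\sigma(t))$ for all $t\in(t_i,t_{i+1})\cap\mathcal{I}$ and all $i$ (with $t_{i+1}=\infty$ if $t_i$ is the last switching time). A trajectory is a pair $(x,\sigma)$ with $x$ a solution corresponding to $\sigma$; it is maximal if $x$ is a maximal (non-extendable) solution, and its domain is then $\mathcal{I}_{(x,\sigma)}=[0,t_{(x,\sigma)})$. $\mathcal{T}$ is the set of all maximal trajectories. A closed covering of $\mathbb{R}^n$ is a family $\chi=\{\chi_\gamma:\gamma\in\Gamma\}$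 of closed sets with $\bigcup_\gamma\chi_\gamma=\mathbb{R}^n$. $\mathcal{T}[\chi]$ is the set of $(x,\sigma)\in\mathcal{T}$ with $x(t)\in\chi_{\sigma(t)}$ for all $t\in\mathcal{I}_{(x,\sigma)}$. Average dwell-time. $\sigma$ has average dwell-time $\tau_D>0$ and chatter bound $N_0\in\mathbb{N}$ if the number of switching times of $\sigma$ in any open finite interval $(\tau_1,\tau_2)\subset\mathbb{R}_+$ is at most $N_0+(\tau_2-\tau_1)/\tau_D$. $\mathcal{S}_a[\tau_D,N_0]$ is the set of such signals and $\mathcal{T}_a[\tau_D,N_0]$ the set of $(x,\sigma)\in\mathcal{T}$ with $\sigma\in\mathcal{S}_a[\tau_D,N_0]$. A sequence $\{(x_k,\sigma_k)\}$ of trajectories is uniformly bounded if there exists $M\ge0$ such that for all $k$, $|x_k(t)|\le M$ for all $t\ge0$ (so each $x_k$ is defined on $[0,\infty)$). SC property. A family $\mathcal{T}^*$ of maximal trajectories has the SC property if for every uniformly bounded sequence $\{(x_k,\sigma_k)\}\subset\mathcal{T}^*$ there exist a subsequence $\{(x_{k_l},\sigma_{k_l})\}$ and a trajectory $(x^*,\sigma^* )\in\mathcal{T}^*$ such that $\{x_{k_l}\}$ converges to $x^*$ uniformly on compact subsets of $\mathbb{R}_+$ and $\lim_{l\to\infty}\sigma_{k_l}(t)=\sigma^*(t)$ for almost every $t\in\mathbb{R}_+$. *)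

(* Defs.v *)
From HB Require Import structures.
From mathcomp Require Import all_boot all_order all_algebra finmap.
From mathcomp Require Import all_classical all_reals all_analysis.

Set Implicit Arguments.
Unset Strict Implicit.
Unset Printing Implicit Defensive.

Import Order.TTheory GRing.Theory Num.Theory.
Import numFieldNormedType.Exports.

Local Open Scope classical_set_scope.
Local Open Scope ring_scope.

(* The index set {1, ..., m} is represented by 'I_m = {0, ..., m-1}.
   Signals and curves are total functions on R, but every predicate below
   depends only on their values on [0, +oo), resp. on the time domain. *)
Notation mode m := (discrete_topology 'I_m).

Section SwitchedSystem.
Variables (R : realType) (n m : nat).
Implicit Types (f : mode m -> 'rV[R]_n -> 'rV[R]_n) (sigma : R -> mode m).
Implicit Types (x : R -> 'rV[R]_n) (I D : set R) (chi : mode m -> set 'rV[R]_n).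

Definition locally_finite D := forall b : R, finite_set (D `&` `[0, b]).

Definition piecewise_constant sigma :=
  exists D, locally_finite D /\
    forall a b : R, 0 <= a -> D `&` `]a, b[ = set0 ->
      forall s t, a < s < b -> a < t < b -> sigma s = sigma t.

Definition switching_signal sigma :=
  piecewise_constant sigma /\
  forall t : R, 0 <= t -> sigma @ t^'+ --> sigma t.

(* t_0 = 0 together with the discontinuities; a right-continuous signal on
   [0, +oo) has no discontinuity at 0. *)
Definition switching_times sigma : set R :=
  [set t | t = 0 \/ (0 < t /\ ~ {for t, continuous sigma})].

(* [0, T) or [0, T] with 0 < T <= +oo; for T = +oo both are [0, +oo). *)
Definition time_domain I :=
  exists T : \bar R, (0 < T)%E /\
    (I = [set t | 0 <= t /\ (t%:E < T)%E] \/
     I = [set t | 0 <= t /\ (t%:E <= T)%E]).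

(* Derivative of a curve defined on I only: the ordinary derivative at interior
   points of I, the one-sided derivative at an end point belonging to I. *)
Definition derivative_on I x (t : R) (v : 'rV[R]_n) :=
  (s - t)^-1 *: (x s - x t) @[s --> within I t^'] --> v.

(* "Smooth" means C^1 (f is merely continuous): off a locally finite set the
   derivative dx exists and is continuous, and it has one-sided limits at all
   points of I.  At an end point of I contained in I, the one-sided
   filter pointing out of I is trivial and the requirement is void. *)
Definition piecewise_smooth I x :=
  {within I, continuous x} /\
  exists D (dx : R -> 'rV[R]_n), [/\ locally_finite D,
    forall t, (I `\` D) t -> derivative_on I x t (dx t),
    {within I `\` D, continuous dx} &
    forall t, I t ->
      (exists v : 'rV[R]_n, dx s @[s --> within I t^'+] --> v) /\
      (exists v : 'rV[R]_n, dx s @[s --> within I t^'-] --> v)].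

(* The union of the sets (t_i, t_(i+1)) `&` I is I minus the switching times. *)
Definition solution f sigma I x :=
  [/\ time_domain I, piecewise_smooth I x &
      forall t, (I `\` switching_times sigma) t ->
        derivative_on I x t (f (sigma t) (x t))].

Definition maximal_solution f sigma I x :=
  solution f sigma I x /\
  forall J y, solution f sigma J y -> I `<=` J ->
    (forall t, I t -> y t = x t) -> J = I.

Record trajectory := Trajectory {
  dom : set R;
  curve : R -> 'rV[R]_n;
  signal : R -> mode m
}.

Definition maximal_trajectories f : set trajectory :=
  [set X | switching_signal (signal X) /\
           maximal_solution f (signal X) (dom X) (curve X)].

Definition closed_covering chi :=
  (forall g, closed (chi g)) /\ \bigcup_g chi g = [set: 'rV[R]_n].

Definition covering_trajectories f chi : set trajectory :=
  [set X | maximal_trajectories f X /\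
           forall t, dom X t -> chi (signal X t) (curve X t)].

Definition average_dwell_time (tauD : R) (N0 : nat) : set (R -> mode m) :=
  [set sigma | switching_signal sigma /\
    forall tau1 tau2 : R, 0 <= tau1 -> tau1 < tau2 ->
      let S := switching_times sigma `&` (`]tau1, tau2[%classic) in
      finite_set S /\
      (#|` fset_set S |)%:R <= N0%:R + (tau2 - tau1) / tauD].

Definition adt_trajectories f (tauD : R) (N0 : nat) : set trajectory :=
  [set X | maximal_trajectories f X /\ average_dwell_time tauD N0 (signal X)].

(* The norm is the library norm of 'rV[R]_n; boundedness does not depend on
   the choice of a norm on R^n. *)
Definition uniformly_bounded (X : nat -> trajectory) :=
  exists M : R, 0 <= M /\
    forall k, dom (X k) = `[0, +oo[%classic /\
      forall t : R, 0 <= t -> `|curve (X k) t| <= M.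

Definition SC_property (F : set trajectory) :=
  forall X : nat -> trajectory,
    (forall k, F (X k)) -> uniformly_bounded X ->
  exists (k : nat -> nat) (Y : trajectory),
    [/\ {homo k : i j / (i < j)%N}, F Y, dom Y = `[0, +oo[%classic,
        forall K : set R, compact K -> K `<=` `[0, +oo[ ->
          {uniform K, (fun l => curve (X (k l))) @ \oo --> curve Y} &
        {ae @lebesgue_measure R, forall t : R, 0 <= t ->
          signal (X (k l)) t @[l --> \oo] --> signal Y t}].

End SwitchedSystem.

(* Main.v *)
(* Call a point t settled by a mode g when all late enough signals are equal to g
   on one common neighbourhood of t. After a diagonal extraction, made possible
   by testing constancy on rational intervals only, late signals switch near
   every unsettled point, so the dwell-time bound on their switching times passes
   to the set of unsettled points. That set is therefore locally finite, and the
   limit signal is the right limit of the settled mode; switching times that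
   merge in the limit need no separate treatment.
   The curves are equi-Lipschitz, so a second extraction makes them converge.
   Near a settled point they all solve the same equation x' = f_g(x), and a mean
   value inequality carries it over to the limit without integrals. An unsettled
   point at which the limit signal happens to be continuous is covered because a
   continuous curve whose derivative extends continuously is differentiable. *)
Require Import Defs.
From mathcomp Require Import all_boot all_order all_algebra.
From mathcomp Require Import all_classical all_reals all_analysis.
From mathcomp Require Import lra.
Set Implicit Arguments.
Unset Strict Implicit.
Unset Printing Implicit Defensive.

Import Order.TTheory GRing.Theory Num.Theory.
Import numFieldNormedType.Exports.
Local Open Scope classical_set_scope.
Local Open Scope ring_scope.

(** * Finite conjunctions along filters and diagonal extraction *)

Lemma filter_all (T : Type) (F : set_system T) (I : eqType) (s : seq I)
    (P : I -> T -> Prop) : Filter F ->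
  (forall i, i \in s -> \forall x \near F, P i x) ->
  \forall x \near F, forall i, i \in s -> P i x.
Proof.
move=> FF; elim: s => [|i s IHs] Ps; first by apply: nearW => x i.
have Ps' : \forall x \near F, forall j, j \in s -> P j x.
  by apply: IHs => j js; apply: Ps; rewrite inE js orbT.
have Pi := Ps _ (mem_head i s).
near=> x => j; rewrite inE => /orP[/eqP ->|]; first by near: x.
by move: j; near: x.
Unshelve. all: by end_near. Qed.

Lemma proper_filter_infinitely_often (G : set_system nat) (P : nat -> Prop) (n : nat) :
  ProperFilter G -> \oo `<=` G -> G P -> exists2 k, (n <= k)%N & P k.
Proof.
move=> PG ooG GP.
have Gn : G [set k | (n <= k)%N] by apply: ooG; exact: nbhs_infty_ge.
have [k [Pk nk]] := filter_ex (filterI GP Gn).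
by exists k.
Qed.

(* The limiting truth values are read off an ultrafilter refining \oo, which
   makes finitely many of them hold simultaneously infinitely often. *)
Lemma diagonal_subsequence (T : countType) (u : nat -> T -> Prop) :
  exists k : nat -> nat, {homo k : i j / (i < j)%N} /\
    forall i : T, (\forall l \near \oo, u (k l) i) \/
                  (\forall l \near \oo, ~ u (k l) i).
Proof.
have [G [UG ooG]] := ultraFilterLemma (@eventually_filter).
pose b i := G [set k | u k i].
have Gb i : G [set k | u k i <-> b i].
  have [Gi|Gi] := in_ultra_setVsetC [set k | u k i] UG.
    by apply: (filterS _ Gi) => k uki; split=> _; [exact: Gi|exact: uki].
  have nb : ~ b i.
    by rewrite /b => bi; have [k []] := filter_ex (filterI Gi bi).
  by apply: filterS Gi => k nuki; split => [/nuki|/nb].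
have GN N : G [set k | forall i, (pickle i <= N)%N -> (u k i <-> b i)].
  have : \forall k \near G, forall j, j \in iota 0 N.+1 ->
      forall i, pickle i = j -> (u k i <-> b i).
    apply: filter_all => j _; have [[i ij]|ni] := pselect (exists i : T, pickle i = j).
      have := Gb i; apply: filterS => k H i' i'j.
      by rewrite (pcan_inj pickleK (etrans i'j (esym ij))).
    by apply: filterE => k i ij; case: ni; exists i.
  by apply: filterS => k H i iN; apply: (H (pickle i)); rewrite // mem_iota ltnS.
have /choice[c cP] : forall nN : nat * nat, exists k, (nN.1 <= k)%N /\
    forall i, (pickle i <= nN.2)%N -> (u k i <-> b i).
  by move=> [n N]; have [k] := proper_filter_infinitely_often n _ ooG (GN N); exists k.
(* Searching from [(k l').+1] on makes [k] strictly increasing, while stage [l] respects every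
   condition of code at most [l]. *)
pose k := fix k l := if l is l'.+1 then c ((k l').+1, l) else c (0, 0)%N.
have kP l : forall i, (pickle i <= l)%N -> (u (k l) i <-> b i).
  by case: l => [|l]; [exact: (cP (0, 0)%N).2|exact: (cP ((k l).+1, l.+1)).2].
exists k; split.
  by apply: homo_ltn => [? ? ?|l]; [exact: ltn_trans|exact: (cP ((k l).+1, l.+1)).1].
move=> i; have [bi|nbi] := pselect (b i); [left|right];
  by exists (pickle i) => // l il; rewrite (kP l).
Qed.

(** * One-sided neighbourhoods *)

Section OneSidedNbhs.
Context {R : realType}.
Implicit Types (t : R) (P : R -> Prop).

Lemma near_rightP t P : (\forall s \near t^'+, P s) <->
  exists2 d : R, 0 < d & forall s, t < s -> s < t + d -> P s.
Proof.
rewrite /at_right near_withinE; split=> [/nbhs_normP[d d0 H]|[d d0 H]].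
  exists d => // s ts std; apply: H => //=.
  by rewrite distrC gtr0_norm ?subr_gt0// ltrBlDl.
apply/nbhs_normP; exists d => // s /= tsd ts; apply: H => //.
by move: tsd; rewrite distrC gtr0_norm ?subr_gt0// ltrBlDl.
Qed.

Lemma near_leftP t P : (\forall s \near t^'-, P s) <->
  exists2 d : R, 0 < d & forall s, t - d < s -> s < t -> P s.
Proof.
rewrite /at_left near_withinE; split=> [/nbhs_normP[d d0 H]|[d d0 H]].
  exists d => // s std ts; apply: H => //=.
  by rewrite gtr0_norm ?subr_gt0// ltrBlDl -ltrBlDr.
apply/nbhs_normP; exists d => // s /= tsd ts; apply: H => //.
by move: tsd; rewrite gtr0_norm ?subr_gt0// ltrBlDl -ltrBlDr.
Qed.
End OneSidedNbhs.

(** * Mean value inequality with right slopes *)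

Section MeanValue.
Context {R : realType} {V : normedModType R}.
Implicit Types (h : R -> V) (a b L : R).

(** For [K > L], consider the supremum [c] of the points up to which the bound with slope [K] and
    slack [e] holds. Continuity gives the bound at [c], and if [c < b] the right slope at [c]
    carries it further, a contradiction. *)
Lemma right_slope_le_increment h a b L : 0 <= L -> a <= b ->
  {within `[a, b], continuous h} ->
  (forall t, a < t < b -> forall K, L < K ->
     \forall s \near t^'+, `|h s - h t| <= K * (s - t)) ->
  `|h b - h a| <= L * (b - a).
Proof.
move=> L0 ab /subspace_continuousP hc hL.
have {}hc t e : a <= t <= b -> 0 < e -> exists2 d : R, 0 < d &
    forall s, a <= s <= b -> `|t - s| < d -> `|h t - h s| <= e.
  move=> tab e0; have /hc/cvgrPdist_le/(_ e e0) : `[a, b]%classic t by rewrite /= in_itv.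
  rewrite near_withinE => /nbhs_normP[d d0 H]; exists d => // s sab ts.
  by apply: H; rewrite //= in_itv.
(* The slack e absorbs the end point a, where the slope is not controlled. *)
suff HK K e : L < K -> 0 < e -> `|h b - h a| <= K * (b - a) + e.
  apply/ler_addgt0Pr => e e0; pose d := e / (b - a + 1).
  have ba1 : 0 < b - a + 1 by lra.
  have d0 : 0 < d by rewrite divr_gt0.
  have ed : e = d * (b - a + 1) by rewrite /d divfK// gt_eqF.
  have LK : L < L + d by rewrite ltrDl.
  have := HK _ _ LK d0; rewrite ed; lra.
move=> LK e0; pose Q u := `|h u - h a| <= K * (u - a) + e.
have K0 : 0 < K by exact: le_lt_trans LK.
pose S := [set r | a <= r <= b /\ forall u, a <= u <= r -> Q u].
have Qa : Q a by rewrite /Q !subrr normr0 mulr0 add0r ltW.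
have Sa : S a.
  split; first by rewrite lexx.
  by move=> u /andP[au ua]; have -> : u = a by apply/eqP; rewrite eq_le ua au.
have supS : has_sup S by split; [exists a|exists b => r [/andP[]]].
pose c := sup S.
have ac : a <= c by exact: sup_upper_bound.
have cb : c <= b by apply: ge_sup; [exists a|move=> r [/andP[]]].
have Qlt u : a <= u -> u < c -> Q u.
  move=> au uc; have cu0 : 0 < c - u by rewrite subr_gt0.
  have [r [_ Sr] ur] := sup_adherent cu0 supS.
  by apply: Sr; rewrite au ltW//; move: ur; rewrite -/c subKr.
have Qc : Q c.
  have [->//|ca] := eqVneq c a.
  have {ca}ac' : a < c by rewrite lt_neqAle eq_sym ca.
  apply/ler_addgt0Pr => e' e'0.
  have [|d d0 hd] := hc c e' _ e'0; first by rewrite ac.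
  pose u := Num.max a (c - d / 2).
  have uc : u < c by rewrite gt_max ac' ltrBlDr ltrDl divr_gt0.
  have au : a <= u by rewrite le_max lexx.
  have cdu : c - d / 2 <= u by rewrite le_max lexx orbT.
  have cu : `|h c - h u| <= e'.
    apply: hd; first by rewrite au (le_trans (ltW uc)).
    by rewrite gtr0_norm ?subr_gt0//; lra.
  have := Qlt u au uc; rewrite /Q => Qu.
  have : K * (u - a) <= K * (c - a) by rewrite ler_pM2l// lerB// ltW.
  have := ler_distD (h u) (h c) (h a); lra.
have Qle u : a <= u -> u <= c -> Q u.
  by move=> au; rewrite le_eqVlt => /predU1P[->//|]; exact: Qlt.
have [cb'|bc] := ltP c b; last first.
  by have <- : c = b by apply/eqP; rewrite eq_le cb bc.
have [d d0 Qd] : exists2 d, 0 < d & forall s, c < s -> s < c + d -> s <= b -> Q s.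
  have [ca|ca] := eqVneq c a.
    have [|d d0 hd] := hc a e _ e0; first by rewrite lexx.
    exists d => // s; rewrite ca => as_ sd sb; rewrite /Q distrC.
    apply: le_trans (hd s _ _) _; first by rewrite ltW.
      by rewrite distrC gtr0_norm ?subr_gt0// ltrBlDl.
    by rewrite lerDr mulr_ge0 ?ltW ?subr_gt0.
  have ac' : a < c by rewrite lt_neqAle eq_sym ca.
  have := hL c; rewrite ac' cb' => /(_ isT _ LK)/near_rightP[d d0 hd].
  exists d => // s cs sd sb; rewrite /Q.
  have := hd s cs sd; have := ler_distD (h c) (h s) (h a); move: Qc; rewrite /Q; lra.
pose s := Num.min b (c + d / 2).
have cs : c < s by rewrite lt_min cb' ltrDl divr_gt0.
have sb : s <= b by rewrite ge_min lexx.
have sd : s < c + d by rewrite gt_min ltrD2l; apply/orP; right; lra.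
suff : s <= c by rewrite leNgt cs.
apply: sup_upper_bound => //; split; first by rewrite sb (le_trans ac (ltW cs)).
move=> u /andP[au us]; have [uc|cu] := leP u c; first exact: Qle.
by apply: Qd => //; [exact: le_lt_trans sd|exact: le_trans sb].
Qed.
(** Splitting the interval at each exceptional point and adding the increments reduces this to the
    case without exceptions. *)
Lemma slope_le_increment h a b L (s : seq R) : 0 <= L -> a <= b ->
  {within `[a, b], continuous h} ->
  (forall t, a < t < b -> t \notin s -> forall K, L < K ->
     \forall u \near t^'+, `|h u - h t| <= K * (u - t)) ->
  `|h b - h a| <= L * (b - a).
Proof.
move=> L0; elim: s a b => [|c s IHs] a b ab hc hL.
  by apply: right_slope_le_increment => // t tab; exact: hL.
have [/andP[ac cb]|nc] := boolP (a < c < b); last first.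
  apply: IHs => // t tab ts; apply: hL => //.
  by rewrite inE negb_or ts andbT; apply: contraNneq nc => <-.
have hac : `|h c - h a| <= L * (c - a).
  apply: IHs; [exact: ltW|apply: continuous_subspaceW hc|].
    by apply: subset_itvl; rewrite bnd_simp ltW.
  move=> t /andP[at_ tc] ts; apply: hL; first by rewrite at_ (lt_trans tc).
  by rewrite inE negb_or ts lt_eqF.
have hcb : `|h b - h c| <= L * (b - c).
  apply: IHs; [exact: ltW|apply: continuous_subspaceW hc|].
    by apply: subset_itvr; rewrite bnd_simp ltW.
  move=> t /andP[ct tb] ts; apply: hL; first by rewrite tb (lt_trans ac).
  by rewrite inE negb_or ts gt_eqF.
by have := ler_distD (h c) (h b) (h a); lra.
Qed.
End MeanValue.

(** * Derivatives of curves on a time domain *)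

Section Derivative.
Context {R : realType} {n : nat}.
Implicit Types (x : R -> 'rV[R]_n) (I : set R) (a b L t : R) (v w : 'rV[R]_n).

(** The form without division passes to limits and matches the mean value inequality. It is trivial
    at [s = t], which turns the deleted neighbourhood into a full one. *)
Lemma derivative_onP I x t v : derivative_on I x t v <->
  forall e, 0 < e -> exists2 d : R, 0 < d & forall s, I s -> `|t - s| < d ->
    `|x s - x t - (s - t) *: v| <= e * `|s - t|.
Proof.
have slopeE s e : s != t ->
    (`|v - (s - t)^-1 *: (x s - x t)| <= e) =
    (`|x s - x t - (s - t) *: v| <= e * `|s - t|).
  move=> st; have st0 : s - t != 0 by rewrite subr_eq0.
  rewrite -ler_pdivrMr ?normr_gt0// mulrC -normfV -normrZ [in RHS]scalerBr.
  by rewrite scalerA mulVf// scale1r distrC.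
rewrite /derivative_on cvgrPdist_le; split=> H e /H.
  rewrite !near_withinE => /nbhs_normP[d d0 dP]; exists d => // s Is std.
  have [->|st] := eqVneq s t.
    by rewrite !subrr scale0r subr0 !normr0 mulr0.
  by rewrite -slopeE//; exact: dP.
move=> [d d0 dP]; rewrite !near_withinE; apply/nbhs_normP.
by exists d => // s /= std st Is; rewrite slopeE//; exact: dP.
Qed.

(** The mean value inequality is applied to [x] minus the uniform motion of velocity [v]. Taking
    [v = 0] yields Lipschitz bounds; taking for [v] an expected derivative yields
    differentiability. *)
Lemma increment_derivative_le I x a b v L (s : seq R) : 0 <= L -> a <= b ->
  `[a, b]%classic `<=` I -> {within I, continuous x} ->
  (forall t, a < t < b -> t \notin s ->
     exists2 w, derivative_on I x t w & `|w - v| <= L) ->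
  `|x b - x a - (b - a) *: v| <= L * (b - a).
Proof.
move=> L0 ab abI xc xd; pose h r := x r - r *: v.
have hE p q : h p - h q = x p - x q - (p - q) *: v.
  by rewrite /h scalerBl !opprD !opprK addrACA.
rewrite -hE; apply: (@slope_le_increment _ _ h _ _ _ s) => //.
  have /subspace_continuousP {}xc := continuous_subspaceW abI xc.
  apply/subspace_continuousP => r rab; apply: cvgB; first exact: xc.
  by apply: cvg_within_filter; exact: scalel_continuous.
move=> t tab ts K LK; have [w /derivative_onP dw wv] := xd t tab ts.
(* The gap [K - L] pays for the differentiation error at [t]. *)
have KL : 0 < K - L by rewrite subr_gt0.
have [d d0 dP] := dw _ KL.
have [at_ tb] := andP tab.
apply/near_rightP; exists (Num.min d (b - t)).
  by rewrite lt_min d0 subr_gt0.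
move=> u tu; rewrite -ltrBlDl lt_min => /andP[ud ub].
have ut0 : 0 < u - t by rewrite subr_gt0.
have Iu : I u by apply: abI; rewrite /= in_itv /=; lra.
have := dP u Iu; rewrite distrC gtr0_norm// => /(_ ud) H.
have -> : h u - h t = (x u - x t - (u - t) *: w) + (u - t) *: (w - v).
  by rewrite hE scalerBr addrA subrK.
apply: le_trans (ler_normD _ _) _; rewrite normrZ gtr0_norm//.
have : (u - t) * `|w - v| <= (u - t) * L by rewrite ler_pM2l.
by lra.
Qed.
End Derivative.

(** * Locally constant functions and locally finite sets *)

Lemma locally_constant_connected (T : topologicalType) (U : Type) (A : set T)
    (h : T -> U) : connected A ->
  (forall t, A t -> \forall s \near t, h s = h t) ->
  forall s t, A s -> A t -> h s = h t.
Proof.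
move=> cA lc s t As At; pose B := A `&` [set r | h r = h t].
(* [B] is relatively open and closed: local constancy puts both agreement and disagreement with
   [h t] into the interior. *)
suff : B = A by move=> BA; have [] : B s by rewrite BA.
apply: cA; first by exists t.
- exists (interior [set r | h r = h t]); first exact: open_interior.
  apply/seteqP; split=> r [Ar hr]; split=> //.
    by have := lc _ Ar; rewrite /= in hr; rewrite hr.
  exact: interior_subset hr.
- exists (~` interior [set r | h r <> h t]); first exact/open_closedC/open_interior.
  apply/seteqP; split=> r [Ar hr]; split=> //.
    by move/interior_subset; apply.
  have [//|nhr] := pselect (h r = h t); case: hr.
  by have := lc _ Ar; apply: filterS => q /= ->.
Qed.

Section LocallyFinite.
Context {R : realType}.
Implicit Types (D : set R) (t : R).

(** Up to [t + 1], the set without [t] is finite, hence closed, and misses a neighbourhood of [t].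
    Only [0 <= s] is covered because local finiteness says nothing about negative times. *)
Lemma locally_finite_isolated D t : locally_finite D ->
  exists2 d : R, 0 < d & forall s, 0 <= s -> s != t -> `|t - s| < d -> ~ D s.
Proof.
move=> /(_ (t + 1)) Dfin; pose F := (D `&` `[0, t + 1]) `\ t.
have : closed F by apply: compact_closed; [exact: Rhausdorff|exact/finite_compact/finite_setD].
move=> Fcl.
have : nbhs t (~` F).
  by apply: open_nbhs_nbhs; split; [exact: closed_openC|case=> _; apply].
move=> /nbhs_normP[d d0 dP]; exists (Num.min d 1); first by rewrite lt_min d0 ltr01.
move=> s s0 st; rewrite lt_min => /andP[sd s1] Ds; apply: (dP s sd).
split; last exact/eqP.
split => //; rewrite /= in_itv/= s0/=.
by move: s1; rewrite distrC => /ltW /ler_normlW; rewrite lerBlDl.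
Qed.

(** Points are counted below on duplicate-free lists; this converts such counts into finiteness of
    the set. *)
Lemma bounded_finite_card D (N : nat) :
  (forall s : seq R, uniq s -> (forall t, t \in s -> D t) -> (size s <= N)%N) ->
  finite_set D /\ (size (finmap.enum_fset (fset_set D)) <= N)%N.
Proof.
move=> DN; have Dfin : finite_set D.
  apply: contrapT => Dinf; have [B BD NB] := infinite_set_fset N.+1 Dinf.
  suff : (size (finmap.enum_fset B) <= N)%N by rewrite leqNgt NB.
  by apply: DN; [exact: finmap.fset_uniq|move=> t tB; exact: BD].
split=> //; apply: DN; first exact: finmap.fset_uniq.
by move=> t; rewrite in_fset_set// inE.
Qed.
End LocallyFinite.

(** * Switching signals and settled points *)

Section Signals.
Context {R : realType} {m : nat}.
Implicit Types (sigma : R -> mode m) (s : nat -> R -> mode m) (g : mode m) (t : R).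

Lemma discrete_continuousP sigma t :
  {for t, continuous sigma} <-> \forall u \near t, sigma u = sigma t.
Proof. exact: discrete_cvg. Qed.

Lemma no_switching_constant sigma (a b : R) : 0 <= a ->
  (forall t, a < t < b -> ~ switching_times sigma t) ->
  forall t u, a < t < b -> a < u < b -> sigma t = sigma u.
Proof.
move=> a0 ns t u tab uab.
apply: (@locally_constant_connected _ _ `]a, b[%classic);
  rewrite /= ?in_itv//; first exact/connected_intervalP/interval_is_interval.
move=> r; rewrite in_itv/= => /[dup] rab /andP[ar _].
apply/discrete_continuousP; apply: contrapT => nc.
by apply: (ns r rab); right; split=> //; exact: le_lt_trans ar.
Qed.

(* Rational end points make this a countable family of conditions. *)
Definition constant_on_rat_itv sigma (pqg : rat * rat * 'I_m) :=
  forall t, ratr pqg.1.1 < t < ratr pqg.1.2 -> sigma t = pqg.2.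

(** The condition [0 <= p] keeps the interval inside the time domain; in particular 0 is never
    settled. *)
Definition settled s g t := exists p q : rat,
  [/\ 0 <= p, ratr p < t < ratr q &
      \forall l \near \oo, constant_on_rat_itv (s l) (p, q, g)].

Lemma settled_near s g t : settled s g t -> exists2 d : R, 0 < d &
  (forall u, `|t - u| < d -> settled s g u) /\
  \forall l \near \oo, forall u, `|t - u| < d -> s l u = g.
Proof.
move=> [p [q [p0 /andP[pt tq] spq]]].
exists (Num.min (t - ratr p) (ratr q - t)); first by rewrite lt_min !subr_gt0 pt.
have tu u : `|t - u| < Num.min (t - ratr p) (ratr q - t) -> ratr p < u < ratr q.
  by rewrite lt_min !ltr_norml => /andP[/andP[? ?] /andP[? ?]]; apply/andP; lra.
split=> [u /tu puq|]; first by exists p, q.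
by apply: filterS spq => l H u /tu; exact: H.
Qed.

Lemma settled_unique s g g' t : settled s g t -> settled s g' t -> g = g'.
Proof.
move=> /settled_near[d d0 [_ H]] /settled_near[d' d'0 [_ H']].
have [l [Hl H'l]] := filter_ex (filterI H H').
by rewrite -(Hl t) ?subrr ?normr0// -(H'l t) ?subrr ?normr0.
Qed.

Lemma settled_pos s g t : settled s g t -> 0 < t.
Proof.
move=> [p [q [p0 /andP[pt _] _]]]; apply: le_lt_trans pt.
by rewrite ler0q.
Qed.

Definition unsettled s : set R := [set t | forall g, ~ settled s g t].

Lemma settledP s t : ~ unsettled s t -> exists g, settled s g t.
Proof. by move=> /existsNP[g /contrapT]; exists g. Qed.

End Signals.

(** * Compactness of signals with average dwell-time *)

Section Compactness.
Context {R : realType} {m : nat} (tauD : R) (N0 : nat) (s : nat -> R -> mode m).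
Hypothesis s_adt : forall l, average_dwell_time tauD N0 (s l).
Hypothesis s_diagonal : forall pqg,
  (\forall l \near \oo, constant_on_rat_itv (s l) pqg) \/
  (\forall l \near \oo, ~ constant_on_rat_itv (s l) pqg).
Local Notation Z := (unsettled s).

(** On a rational interval around an unsettled point no mode is held eventually. The diagonal
    hypothesis strengthens this to every mode eventually failing, so one late index serves all modes
    and all points of [r]. *)
Lemma unsettled_switching (r : seq R) (d : R) : 0 < d ->
  (forall t, t \in r -> Z t /\ 0 <= t - d) ->
  exists l, forall t, t \in r -> exists u,
    switching_times (s l) u /\ t - d < u < t + d.
Proof.
move=> d0 rZ.
have : \forall l \near \oo, forall t, t \in r -> exists u,
    switching_times (s l) u /\ t - d < u < t + d.
  apply: filter_all => t tr; have [Zt td0] := rZ t tr.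
  have [p] := @rat_in_itvoo R (t - d) t ltac:(lra).
  have [q] := @rat_in_itvoo R t (t + d) ltac:(lra).
  rewrite !in_itv/= => /andP[tq qd] /andP[pd pt].
  have p0 : 0 <= p by rewrite -(ler0q R) (le_trans td0)// ltW.
  have : \forall l \near \oo, forall g, g \in enum 'I_m ->
      ~ constant_on_rat_itv (s l) (p, q, g).
    apply: filter_all => g _; have [H|//] := s_diagonal (p, q, g).
    by case: (Zt g); exists p, q; split; rewrite ?pt.
  apply: filterS => l nc; apply: contrapT => nsw.
  (* Without a switching time nearby, the signal would keep its own value at [t] on the whole
     interval. *)
  apply: (nc (s l t)); first by rewrite mem_enum.
  move=> v /= pvq; apply: (@no_switching_constant _ _ (s l) (ratr p) (ratr q)) => //.
  - by rewrite ler0q.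
  - move=> u /andP[pu uq] su; apply: nsw; exists u; split=> //.
    by rewrite (lt_trans pd)// (lt_trans uq).
  - by rewrite pt.
by case/filter_ex => l; exists l.
Qed.

(** The listed points are the centres of disjoint intervals inside []a, b[], and a single late
    signal switches in each of them, so its dwell-time bound limits the length of the list. *)
Lemma unsettled_count (a b : R) (r : seq R) : 0 <= a -> a < b -> uniq r ->
  (forall t, t \in r -> a < t < b /\ Z t) ->
  (size r)%:R <= N0%:R + (b - a) / tauD.
Proof.
move=> a0 ab ur rZ.
have sep : \forall d \near (0 : R)^'+, forall t, t \in r ->
    [/\ d <= t - a, d <= b - t &
        forall u, u \in r -> u != t -> d *+ 2 <= `|t - u|].
  apply: filter_all => t tr; have [/andP[at_ tb] _] := rZ t tr.
  have H : \forall d \near (0 : R)^'+, forall u, u \in r -> u != t ->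
      d *+ 2 <= `|t - u|.
    apply: filter_all => u ur'; have [->|ut] := eqVneq u t; first exact: nearW.
    have tu : 0 < `|t - u| / 2 by rewrite divr_gt0// normr_gt0 subr_eq0 eq_sym.
    near=> d => _; have : d <= `|t - u| / 2 by near: d; exact: nbhs_right_le.
    by rewrite (mulr2n d); lra.
  near=> d; split; last by near: d.
    by near: d; apply: nbhs_right_le; rewrite subr_gt0.
  by near: d; apply: nbhs_right_le; rewrite subr_gt0.
have [d [d0 dP]] := filter_ex (filterI (nbhs_right_gt (0 : R)) sep).
have [|l lP] := unsettled_switching (r := r) d0.
  move=> t tr; have [_ Zt] := rZ t tr; have [da _ _] := dP t tr.
  by split=> //; lra.
have [_ /(_ a b a0 ab)[Sfin]] := s_adt l; apply: le_trans; rewrite ler_nat.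
have /choice[e eP] : forall t, exists u, t \in r ->
    switching_times (s l) u /\ t - d < u < t + d.
  move=> t; have [tr|ntr] := boolP (t \in r); last by exists 0.
  by have [u uP] := lP t tr; exists u.
(* The map [e] from points to switching times is injective on [r], since points sharing a switching
   time would be less than [d *+ 2] apart. *)
rewrite -(size_map e); apply: uniq_leq_size.
  rewrite map_inj_in_uniq// => t u tr ur' etu.
  apply/eqP; apply: contrapT => /negP tu.
  have [_ /andP[te et]] := eP t tr; have [_ /andP[ue eu]] := eP u ur'.
  have [_ _ /(_ t tr tu)] := dP u ur'; rewrite leNgt => /negP; apply.
  by rewrite ltr_norml mulr2n; apply/andP; lra.
move=> _ /mapP[t tr ->]; rewrite in_fset_set// inE.
have [se /andP[te et]] := eP t tr; have [da db _] := dP t tr.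
by split=> //; rewrite /= in_itv/=; apply/andP; lra.
Unshelve. all: by end_near. Qed.

Lemma unsettled_finite (a b : R) : 0 <= a -> a < b ->
  let S := Z `&` `]a, b[%classic in finite_set S /\
  (size (finmap.enum_fset (fset_set S)))%:R <= N0%:R + (b - a) / tauD.
Proof.
move=> a0 ab S; set M := _ + _.
have rM r : uniq r -> (forall t, t \in r -> S t) -> (size r)%:R <= M.
  move=> ur rS; apply: unsettled_count => // t /rS[Zt].
  by rewrite /= in_itv.
(* The empty list already shows [M] nonnegative, so [M] may be truncated to a natural number; the
   real bound is recovered afterwards. *)
have M0 : 0 <= M by have := rM [::]; apply.
have [Sfin _] := @bounded_finite_card R S (Num.truncn M) (fun r ur rS =>
  etrans (truncn_ge_nat _ M0) (rM r ur rS)).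
split=> //; apply: rM => [|t]; first exact: finmap.fset_uniq.
by rewrite in_fset_set// inE.
Qed.

Lemma unsettled_locally_finite : locally_finite Z.
Proof.
move=> b; have [b0|b0] := ltP b 0.
  apply: (@sub_finite_set _ _ set0) => // t [_]; rewrite /= in_itv/= => /andP[? ?].
  by lra.
have b1 : 0 < b + 1 by lra.
have [Zfin _] := unsettled_finite (lexx 0) b1.
(* The count concerns open intervals: 0 is added by hand, and [b] is enclosed by going up to
   [b + 1]. *)
apply: (@sub_finite_set _ _ ([set 0] `|` (Z `&` `]0, (b + 1)[%classic))).
  move=> t [Zt]; rewrite /= in_itv/= => /andP[]; rewrite le_eqVlt.
  move=> /predU1P[<- _|t0 tb]; [by left|right].
  by split=> //; rewrite /= in_itv/= t0; lra.
by rewrite finite_setU.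
Qed.

(** Unsettled points are isolated, so an open interval to the right of [t] is settled throughout.
    The settling mode is unique and locally constant there, hence constant by connectedness. *)
Lemma settled_right t : 0 <= t -> exists g, \forall u \near t^'+, settled s g u.
Proof.
move=> t0; have [d d0 dP] := locally_finite_isolated t unsettled_locally_finite.
have st u : t < u < t + d -> exists g, settled s g u.
  move=> /andP[tu ud]; apply: settledP; apply: dP; last first.
  - by rewrite distrC gtr0_norm ?subr_gt0// ltrBlDl.
  - by rewrite gt_eqF.
  - by rewrite (le_trans t0)// ltW.
have /choice[h hP] : forall u, exists g, t < u < t + d -> settled s g u.
  move=> u; have [/st[g ?]|_] := boolP (t < u < t + d); first by exists g.
  (* An arbitrary value; the signals themselves witness that a mode exists. *)
  by exists (s 0 0).
have tm : t < t + d / 2 < t + d by apply/andP; lra.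
exists (h (t + d / 2)); apply/near_rightP; exists d => // u tu ud.
have tud : t < u < t + d by rewrite tu.
suff -> : h (t + d / 2) = h u by exact: hP.
apply: (@locally_constant_connected _ _ `]t, (t + d)[%classic);
  rewrite /= ?in_itv//; first exact/connected_intervalP/interval_is_interval.
move=> v; rewrite in_itv/= => tvd.
have [e e0 [eP _]] := settled_near (hP v tvd).
have /andP[tv vd] := tvd.
apply/nbhs_normP; exists (Num.min e (Num.min (v - t) (t + d - v))).
  by rewrite /= !lt_min e0 !subr_gt0 tv.
move=> w /=; rewrite !lt_min => /and3P[/eP we vt dv].
apply: settled_unique (hP w _) we.
by move: vt dv; rewrite !ltr_norml => /andP[? ?] /andP[? ?]; apply/andP; lra.
Qed.

(** Defining the limit by right limits of the settling mode builds in right continuity. Its positive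
    discontinuities are unsettled points and inherit their bound. *)
Lemma settled_limit : exists2 sigma : R -> mode m,
  average_dwell_time tauD N0 sigma &
  forall t g, settled s g t -> sigma t = g.
Proof.
have /choice[sigma sigmaP] : forall t, exists g, 0 <= t ->
    \forall u \near t^'+, settled s g u.
  move=> t; have [/settled_right[g ?]|_] := boolP (0 <= t); first by exists g.
  by exists (s 0 0).
have sigmaE t g : settled s g t -> sigma t = g.
  move=> stg; have /sigmaP st := ltW (settled_pos stg).
  have [d d0 [dP _]] := settled_near stg.
  have : \forall u \near t^'+, settled s g u.
    apply/near_rightP; exists d => // u tu ud; apply: dP.
    by rewrite distrC gtr0_norm ?subr_gt0// ltrBlDl.
  move=> H; have [u [su su']] := @filter_ex _ _ (at_right_proper_filter t) _ (filterI st H).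
  exact: settled_unique su su'.
have sigma_near t : ~ Z t -> \forall u \near t, sigma u = sigma t.
  move=> /settledP[g stg]; have [d d0 [dP _]] := settled_near stg.
  apply/nbhs_normP; exists d => // u /= /dP/sigmaE ->; exact/esym/sigmaE.
exists sigma => //; split; [split|].
- exists Z; split; first exact: unsettled_locally_finite.
  move=> a b a0 Zab t u tab uab.
  apply: (@locally_constant_connected _ _ `]a, b[%classic);
    rewrite /= ?in_itv//; first exact/connected_intervalP/interval_is_interval.
  by move=> v vab; apply: sigma_near => Zv; suff : set0 v by []; rewrite -Zab.
- move=> t t0; apply/discrete_cvg; have := sigmaP t t0.
  by apply: filterS => u /sigmaE.
move=> a b a0 ab S; have [Zfin Zcard] := unsettled_finite a0 ab.
have SZ : S `<=` Z `&` `]a, b[.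
  move=> t [st tab]; split=> //; have : 0 < t.
    by move: tab; rewrite /= in_itv/= => /andP[at_ _]; exact: le_lt_trans at_.
  case: st => [->|[_ nct] _]; first by rewrite ltxx.
  apply: contrapT => /sigma_near.
  by move=> /discrete_continuousP.
have Sfin := sub_finite_set SZ Zfin; split=> //; apply: le_trans Zcard.
rewrite ler_nat uniq_leq_size// ?finmap.fset_uniq// => t.
by rewrite !in_fset_set// !inE; exact: SZ.
Qed.
End Compactness.

(** Agreement on a whole neighbourhood, rather than mere pointwise convergence, is what later lets
    the differential equation pass to the limit. *)
Lemma average_dwell_time_compact (R : realType) (m : nat) (tauD : R) (N0 : nat)
    (s : nat -> R -> mode m) : (forall l, average_dwell_time tauD N0 (s l)) ->
  exists (k : nat -> nat) (sigma : R -> mode m) (D : set R),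
  [/\ {homo k : i j / (i < j)%N}, average_dwell_time tauD N0 sigma,
      locally_finite D &
      forall t, ~ D t -> exists2 d : R, 0 < d &
        (forall u, `|t - u| < d -> 0 <= u /\ sigma u = sigma t) /\
        \forall l \near \oo, forall u, `|t - u| < d -> s (k l) u = sigma t].
Proof.
move=> s_adt.
have [k [kmono kP]] :=
  diagonal_subsequence (fun l pqg => constant_on_rat_itv (s l) pqg).
have sk_adt l : average_dwell_time tauD N0 (s (k l)) by [].
have [sigma sigma_adt sigmaE] := settled_limit sk_adt kP.
exists k, sigma, (unsettled (s \o k)); split=> //.
  exact: unsettled_locally_finite sk_adt kP.
move=> t /settledP[g stg]; have [d d0 [dP lP]] := settled_near stg.
exists d => //; rewrite (sigmaE _ _ stg); split=> // u /dP sug.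
by rewrite (sigmaE _ _ sug) (ltW (settled_pos sug)).
Qed.

(** * Compactness of equi-Lipschitz curves *)

Section Curves.
Context {R : realType} {n : nat}.
Implicit Types (x : nat -> R -> 'rV[R]_n) (v : 'rV[R]_n) (L M e t : R).

Lemma rV_coord_norm_le v i : `|v ord0 i| <= `|v|.
Proof.
rewrite [leRHS]/Num.Def.normr /= mx_normrE.
by apply: (@le_bigmax _ _ _ 0 (fun ij => `|v ij.1 ij.2|) (ord0, i)).
Qed.

Lemma rV_norm_le v e : 0 <= e -> (forall i, `|v ord0 i| <= e) -> `|v| <= e.
Proof.
move=> e0 ve; rewrite [leLHS]/Num.Def.normr /= mx_normrE.
by apply/bigmax_leP; split=> // -[i j] _; rewrite ord1.
Qed.

(** The limit is a Dedekind cut: the infimum of the rationals eventually above [v]. By the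
    dichotomy, rationals below it eventually bound [v] from below. *)
Lemma rat_cut_cvg (v : nat -> R) M : (forall l, `|v l| <= M) ->
  (forall r : rat, (\forall l \near \oo, v l < ratr r) \/
                   (\forall l \near \oo, ~ (v l < ratr r))) ->
  exists c : R, v @ \oo --> c.
Proof.
move=> vM cut; pose E := [set (ratr r : R) | r in [set r | \forall l \near \oo, v l < ratr r]].
have infE : has_inf E.
  split.
    have [r] := @rat_in_itvoo R M (M + 1) ltac:(lra).
    rewrite in_itv/= => /andP[Mr _]; exists (ratr r); exists r => //.
    by apply: nearW => l; apply: le_lt_trans Mr; exact: ler_normlW.
  exists (- M) => _ [r rE <-]; have [l vl] := filter_ex rE.
  by have := vM l; rewrite ler_norml => /andP[]; lra.
exists (inf E); apply/cvgrPdist_le => e e0.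
have [_ [r rE <-] re] := inf_adherent e0 infE.
have [r'] := @rat_in_itvoo R (inf E - e) (inf E) ltac:(lra).
rewrite in_itv/= => /andP[er' r'E].
have nr' : \forall l \near \oo, ~ (v l < ratr r').
  have [H|//] := cut r'; suff : inf E <= ratr r' by rewrite leNgt r'E.
  by apply: (inf_lbound infE.2); exists r'.
apply: filterS2 rE nr' => l vr /negP; rewrite -leNgt => r'v.
by rewrite ler_norml; apply/andP; lra.
Qed.

(** As in the Arzelà-Ascoli theorem, a diagonal extraction over rational times, coordinates and
    rational cuts gives convergence at rational times; the common Lipschitz constant extends it to
    all times. *)
Lemma lipschitz_sequence_compact x L M : 0 <= L ->
  (forall l t, 0 <= t -> `|x l t| <= M) ->
  (forall l s t, 0 <= s -> 0 <= t -> `|x l s - x l t| <= L * `|s - t|) ->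
  exists (k : nat -> nat) (y : R -> 'rV[R]_n), {homo k : i j / (i < j)%N} /\
    forall t, 0 <= t -> x (k l) t @[l --> \oo] --> y t.
Proof.
move=> L0 xM xL; have [k [kmono kP]] := diagonal_subsequence
  (fun l (qir : rat * 'I_n * rat) => x l (ratr qir.1.1) ord0 qir.1.2 < ratr qir.2).
have cvg_rat (q : rat) : 0 <= q -> exists c : 'rV[R]_n, x (k l) (ratr q) @[l --> \oo] --> c.
  move=> q0; have q0' : (0 : R) <= ratr q by rewrite ler0q.
  have /choice[c cP] : forall i, exists c : R, x (k l) (ratr q) ord0 i @[l --> \oo] --> c.
    move=> i; apply: (@rat_cut_cvg _ M) => [l|r]; last exact: kP (q, i, r).
    by apply: le_trans (rV_coord_norm_le _ _) _; exact: xM.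
  exists (\row_i c i); apply/cvgrPdist_le => e e0.
  have : \forall l \near \oo, forall i, i \in enum 'I_n ->
      `|c i - x (k l) (ratr q) ord0 i| <= e.
    by apply: filter_all => i _; move/cvgrPdist_le: (cP i); exact.
  apply: filterS => l H; apply: rV_norm_le; first exact: ltW.
  by move=> i; rewrite !mxE; apply: H; rewrite mem_enum.
have /choice[y yP] : forall t, exists y : 'rV[R]_n, 0 <= t -> x (k l) t @[l --> \oo] --> y.
  move=> t; have [t0|_] := boolP (0 <= t); last by exists 0.
  suff /cauchy_cvgP H : cauchy (x (k l) t @[l --> \oo]) by exists (lim (x (k l) t @[l --> \oo])).
  (* Within time [d] a curve moves by less than [e / 2]; dividing by [L + 1] also covers [L = 0]. *)
  apply/cauchy_exP => e e0; pose d := e / 2 / (L + 1).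
  have L1 : 0 < L + 1 by lra.
  have d0 : 0 < d by rewrite !divr_gt0.
  have dE : d * (L + 1) = e / 2 by rewrite divfK// gt_eqF.
  have [q] := @rat_in_itvoo R t (t + d) ltac:(lra).
  rewrite in_itv/= => /andP[tq qd].
  have q0 : 0 <= q by rewrite -(ler0q R); lra.
  have [c /cvgrPdist_le/(_ (e / 2) ltac:(lra)) cq] := cvg_rat q q0.
  exists c; apply: filterS cq => l H; rewrite -ball_normE /=.
  have := xL (k l) (ratr q) t ltac:(lra) t0.
  rewrite [X in L * X]gtr0_norm ?subr_gt0//.
  have : L * (ratr q - t) <= L * d by rewrite ler_wpM2l//; lra.
  have := ler_distD (x (k l) (ratr q)) c (x (k l) t).
  lra.
by exists k, y.
Qed.

Lemma lipschitz_limit x (y : R -> 'rV[R]_n) L : (forall t, 0 <= t -> x l t @[l --> \oo] --> y t) ->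
  (forall l s t, 0 <= s -> 0 <= t -> `|x l s - x l t| <= L * `|s - t|) ->
  forall s t, 0 <= s -> 0 <= t -> `|y s - y t| <= L * `|s - t|.
Proof.
move=> xy xL s t s0 t0.
have : `|x l s - x l t| @[l --> \oo] --> `|y s - y t|.
  by apply: cvg_norm; apply: cvgB; exact: xy.
by move=> H; apply: (cvgr_to_le H); apply: nearW => l; exact: xL.
Qed.

(** Convergence at one time spreads to a neighbourhood independent of the index, and compactness of
    [K] then provides a common index. *)
Lemma lipschitz_cvg_compact x (y : R -> 'rV[R]_n) L (K : set R) : 0 <= L ->
  (forall t, 0 <= t -> x l t @[l --> \oo] --> y t) ->
  (forall l s t, 0 <= s -> 0 <= t -> `|x l s - x l t| <= L * `|s - t|) ->
  compact K -> K `<=` `[0, +oo[ -> {uniform K, x @ \oo --> y}.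
Proof.
move=> L0 xy xL cK K0; have yL := lipschitz_limit xy xL.
have {}K0 t : K t -> 0 <= t by move/K0; rewrite /= in_itv/= andbT.
have cvgK e : 0 < e -> \forall l \near \oo, forall t, K t -> `|y t - x l t| < e.
  (* Three errors of at most [e / 4] add up to less than [e]: the motion of [y], that of [x l], and
     their distance at [t]. *)
  move=> e0; pose d := e / 4 / (L + 1).
  have L1 : 0 < L + 1 by lra.
  have d0 : 0 < d by rewrite !divr_gt0.
  have dE : d * (L + 1) = e / 4 by rewrite divfK// gt_eqF.
  apply: ((near_covering_withinP K).2 ((compact_near_coveringP K).1 cK)) => t Kt.
  have xt : \forall l \near \oo, `|y t - x l t| <= e / 4.
    by move/cvgrPdist_le: (xy t (K0 t Kt)); apply; lra.
  have td : \forall s \near t, `|t - s| <= d by apply/nbhs_normP; exists d => // s /=; exact: ltW.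
  exists ([set s | `|t - s| <= d], [set l | `|y t - x l t| <= e / 4]) => //.
  move=> [s l] [/= ts xtl] Ks.
  have := yL s t (K0 _ Ks) (K0 _ Kt); have := xL l s t (K0 _ Ks) (K0 _ Kt).
  rewrite [`|s - t|]distrC [`|x l s - x l t|]distrC.
  have : L * `|t - s| <= L * d by rewrite ler_wpM2l.
  have := ler_distD (y t) (y s) (x l s); have := ler_distD (x l t) (y t) (x l s).
  lra.
move=> P /uniform_nbhs[E [+ EP]]; rewrite -entourage_ballE => -[e e0 eE].
have := cvgK e e0; apply: filterS => l H; apply: EP => t Kt; apply: eE => /=.
by rewrite -ball_normE; exact: H.
Qed.
End Curves.

(** * Estimates for solutions and passage to the limit *)

Section Solutions.
Context {R : realType} {n m : nat}.
Implicit Types (f : mode m -> 'rV[R]_n -> 'rV[R]_n) (sigma : R -> mode m).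
Implicit Types (x y : R -> 'rV[R]_n) (v w : 'rV[R]_n) (g : mode m) (L M t : R).
Local Notation I := (`[0%R, +oo[%classic : set R).

Lemma field_bound f M : (forall g, continuous (f g)) ->
  exists2 L, 0 < L & forall g v, `|v| <= M -> `|f g v| <= L.
Proof.
move=> fc; pose K := [set v : 'rV[R]_n | `|v| <= M].
have cK : compact K.
  apply: bounded_closed_compact.
    by exists M; split; [exact: num_real|move=> N MN v /= vM; rewrite (le_trans vM)// ltW].
  apply: (@closed_comp _ _ (fun v : 'rV[R]_n => `|v|) [set r | r <= M]); last exact: closed_le.
  by move=> v _; exact: norm_continuous.
have Hg : \forall L \near +oo, forall g, g \in enum 'I_m ->
    forall v, `|v| <= M -> `|f g v| <= L.
  apply: filter_all => g _.
  have : compact (f g @` K).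
    by apply: continuous_compact => //; exact: continuous_subspaceT.
  move=> /compact_bounded[N [Nreal NP]]; exists N; split=> // L NL v vM.
  by apply: (NP L NL); exists v.
have [L L0 HL] := pinfty_ex_gt0 Hg.
by exists L => // g; apply: HL; rewrite mem_enum.
Qed.

(** Both sides of [t] are treated at once. Derivatives are tested at positive times other than [t],
    so [t] may be 0 or an exceptional time. *)
Lemma increment_near_le x s t v L : 0 <= L -> 0 <= s -> 0 <= t ->
  {within I, continuous x} ->
  (forall r, 0 < r -> r != t -> `|t - r| < `|t - s| ->
     exists2 w, derivative_on I x r w & `|w - v| <= L) ->
  `|x s - x t - (s - t) *: v| <= L * `|s - t|.
Proof.
move=> L0 s0 t0 xc xd.
have subI a b : 0 <= a -> `[a, b]%classic `<=` I.
  by move=> a0 r; rewrite /= !in_itv/= andbT => /andP[ar _]; exact: le_trans ar.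
have [st|ts|->] := ltgtP s t; last by rewrite !subrr scale0r subrr !normr0 mulr0.
- have -> : x s - x t - (s - t) *: v = - (x t - x s - (t - s) *: v).
    by rewrite -(opprB t s) scaleNr opprK !opprD !opprK (addrC (x s)).
  rewrite normrN [`|s - t|]distrC [X in _ * X]gtr0_norm ?subr_gt0//.
  apply: (@increment_derivative_le _ _ I x s t v L [::] L0 (ltW st) (subI _ _ s0) xc).
  move=> r /andP[sr rt] _; apply: xd; first exact: le_lt_trans sr.
    by rewrite lt_eqF.
  by rewrite !gtr0_norm ?subr_gt0//; lra.
- rewrite [X in _ * X]gtr0_norm ?subr_gt0//.
  apply: (@increment_derivative_le _ _ I x t s v L [::] L0 (ltW ts) (subI _ _ t0) xc).
  move=> r /andP[tr rs] _; apply: xd; first exact: le_lt_trans tr.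
    by rewrite gt_eqF.
  by rewrite distrC [ltRHS]distrC !gtr0_norm ?subr_gt0//; lra.
Qed.

(** The dwell-time makes the switching times between [s] and [t] finite in number; they form the
    exceptional list of the mean value inequality. *)
Lemma solution_lipschitz f sigma x tauD N0 M L : 0 <= L ->
  (forall g v, `|v| <= M -> `|f g v| <= L) ->
  average_dwell_time tauD N0 sigma -> solution f sigma I x ->
  (forall t, 0 <= t -> `|x t| <= M) ->
  forall s t, 0 <= s -> 0 <= t -> `|x s - x t| <= L * `|s - t|.
Proof.
move=> L0 fL [_ adt] [_ [xc _] xd] xM.
suff H s t : 0 <= s -> s < t -> `|x t - x s| <= L * (t - s).
  move=> s t s0 t0; have [st|ts|->] := ltgtP s t; last by rewrite !subrr !normr0 mulr0.
    by rewrite distrC [`|s - t|]distrC [X in _ * X]gtr0_norm ?subr_gt0//; exact: H.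
  by rewrite [X in _ * X]gtr0_norm ?subr_gt0//; exact: H.
move=> s0 st; have [Sfin _] := adt s t s0 st.
have := @increment_derivative_le _ _ I x s t 0 L
  (finmap.enum_fset (fset_set (switching_times sigma `&` `]s, t[))) L0 (ltW st).
rewrite scaler0 subr0; apply=> //.
  by move=> r; rewrite /= !in_itv/= andbT => /andP[sr _]; exact: le_trans sr.
move=> r srt; rewrite in_fset_set// notin_setE => nr.
have r0 : 0 <= r by case/andP: srt => sr _; rewrite (le_trans s0)// ltW.
exists (f (sigma r) (x r)); last by rewrite subr0; apply: fL; exact: xM.
apply: xd; split; first by rewrite /= in_itv/= r0.
by move=> sr; apply: nr; split=> //; rewrite /= in_itv.
Qed.

Lemma constant_not_switching sigma g t d : 0 < t -> 0 < d ->
  (forall u, `|t - u| < d -> sigma u = g) -> ~ switching_times sigma t.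
Proof.
move=> t0 d0 sg [t0'|[_]]; first by rewrite t0' ltxx in t0.
apply; apply/discrete_continuousP; apply/nbhs_normP; exists d => // u /= tu.
by rewrite !sg// subrr normr0.
Qed.

(** Near [t] the derivatives are close to [f g (y t)] by continuity, so the mean value inequality
    with that velocity gives the derivative at [t]. *)
Lemma derivative_extension f g y t d : 0 < d -> 0 <= t -> continuous (f g) ->
  {within I, continuous y} ->
  (forall r, 0 < r -> r != t -> `|t - r| < d -> derivative_on I y r (f g (y r))) ->
  derivative_on I y t (f g (y t)).
Proof.
move=> d0 t0 fc yc yd; apply/derivative_onP => e e0.
have It : I t by rewrite /= in_itv/= t0.
have : f g (y u) @[u --> within I (nbhs t)] --> f g (y t).
  by apply: continuous_cvg; [exact: fc|exact: (subspace_continuousP _ _).1].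
move=> /cvgrPdist_le/(_ e e0); rewrite near_withinE => /nbhs_normP[d' d'0 d'P].
exists (Num.min d d'); first by rewrite lt_min d0.
move=> s; rewrite /= in_itv/= andbT => s0; rewrite lt_min => /andP[sd sd'].
apply: increment_near_le => //; first exact: ltW.
move=> r r0 rt trs; exists (f g (y r)).
  by apply: yd => //; exact: lt_trans sd.
by rewrite distrC; apply: d'P; rewrite /= ?in_itv/= ?ltW//; exact: lt_trans sd'.
Qed.

(** The first-order estimate at [t] holds for all late curves with a radius independent of [l], so
    it survives pointwise convergence. *)
Lemma limit_derivative f g (x : nat -> R -> 'rV[R]_n) (s : nat -> R -> mode m) y L t d :
  0 <= L -> 0 < d -> continuous (f g) -> (forall u, `|t - u| < d -> 0 <= u) ->
  (forall l, solution f (s l) I (x l)) ->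
  (forall l u r, 0 <= u -> 0 <= r -> `|x l u - x l r| <= L * `|u - r|) ->
  (forall u, 0 <= u -> x l u @[l --> \oo] --> y u) ->
  (\forall l \near \oo, forall u, `|t - u| < d -> s l u = g) ->
  derivative_on I y t (f g (y t)).
Proof.
move=> L0 d0 fc tpos xsol xL xy sg; apply/derivative_onP => e e0.
have t0 : 0 <= t by apply: tpos; rewrite subrr normr0.
have /cvgrPdist_le/(_ e e0)/nbhs_normP[c c0 cP] := fc (y t).
(* Within time [h] a curve moves by less than [c / 2]; with [x l t] within [c / 2] of [y t], it
   stays where [f g] is [e]-close to [f g (y t)]. *)
pose h := c / 2 / (L + 1).
have L1 : 0 < L + 1 by lra.
have h0 : 0 < h by rewrite !divr_gt0.
have hE : h * (L + 1) = c / 2 by rewrite divfK// gt_eqF.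
exists (Num.min d h); first by rewrite lt_min d0.
move=> u; rewrite /= in_itv/= andbT => u0; rewrite lt_min => /andP[ud uh].
have : `|x l u - x l t - (u - t) *: f g (y t)| @[l --> \oo] -->
    `|y u - y t - (u - t) *: f g (y t)|.
  by apply: cvg_norm; apply: cvgB; [apply: cvgB; exact: xy|exact: cvg_cst].
move=> H; apply: (cvgr_to_le H).
have xt : \forall l \near \oo, `|y t - x l t| < c / 2.
  by move/cvgrPdist_lt: (xy t t0); apply; rewrite divr_gt0.
apply: filterS2 sg xt => l sg xt.
have [_ [xc _] xd] := xsol l.
apply: increment_near_le => //; first exact: ltW.
move=> r r0 rt tru; have trd : `|t - r| < d by exact: lt_trans ud.
exists (f g (x l r)).
  rewrite -(sg r trd); apply: xd; split; first by rewrite /= in_itv/= ltW.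
  apply: (@constant_not_switching _ g r (d - `|t - r|)) => //.
    by rewrite subr_gt0.
  by move=> v vr; apply: sg; have := ler_distD r t v; lra.
rewrite distrC; apply: cP => /=.
have := xL l t r t0 (ltW r0); have := ler_distD (x l t) (y t) (x l r).
have : L * `|t - r| <= L * h by rewrite ler_wpM2l// ltW// (lt_trans tru).
by lra.
Qed.
End Solutions.

(** * The limit trajectory *)

Lemma locally_finite_countable (R : realType) (D : set R) :
  locally_finite D -> countable (D `&` `[0, +oo[).
Proof.
move=> Dfin; apply: (@sub_countable _ _ _ (\bigcup_(N in [set: nat]) (D `&` `[0, N%:R]))).
  apply: subset_card_le => t [Dt]; rewrite /= in_itv/= andbT => t0.
  exists (Num.truncn t).+1 => //; split=> //; rewrite /= in_itv/= t0/= ltW//.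
  exact: truncnS_gt.
by apply: bigcup_countable => // N _; exact/finite_set_countable/Dfin.
Qed.

Lemma near_subseq (k : nat -> nat) (P : nat -> Prop) :
  {homo k : i j / (i < j)%N} -> (\forall l \near \oo, P l) ->
  \forall l \near \oo, P (k l).
Proof.
move=> kmono [N _ NP]; have kge l : (l <= k l)%N.
  by elim: l => // l IHl; exact: leq_ltn_trans IHl (kmono _ _ (ltnSn l)).
by exists N => // l /= Nl; apply: NP; exact: leq_trans (kge l).
Qed.

Section LimitTrajectory.
Context {R : realType} {n m : nat}.
Variables (f : mode m -> 'rV[R]_n -> 'rV[R]_n) (sigma : R -> mode m).
Variables (y : R -> 'rV[R]_n) (L : R) (D : set R).
Local Notation I := (`[0%R, +oo[%classic : set R).
Hypothesis fc : forall g, continuous (f g).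
Hypothesis L0 : 0 <= L.
Hypothesis yL : forall s t, 0 <= s -> 0 <= t -> `|y s - y t| <= L * `|s - t|.
Hypothesis sigma_signal : switching_signal sigma.
Hypothesis D_finite : locally_finite D.
Hypothesis sigma_const : forall t, ~ D t -> exists2 d : R, 0 < d &
  forall u, `|t - u| < d -> 0 <= u /\ sigma u = sigma t.
Hypothesis yd : forall t, ~ D t -> derivative_on I y t (f (sigma t) (y t)).

Lemma lipschitz_continuous_on : {within I, continuous y}.
Proof.
apply/subspace_continuousP => t; rewrite /= in_itv/= andbT => t0.
apply/cvgrPdist_le => e e0; have L1 : 0 < L + 1 by rewrite ltr_wpDl.
rewrite near_withinE; apply/nbhs_normP; exists (e / (L + 1)); first exact: divr_gt0.
move=> u /= tu; rewrite in_itv/= andbT => u0; apply: le_trans (yL t0 u0) _.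
apply: (@le_trans _ _ ((L + 1) * `|t - u|)); first by rewrite ler_wpM2r// lerDl.
by rewrite mulrC -ler_pdivlMr// ltW.
Qed.

(** The filter is left general to serve both continuity off [D] and the two one-sided limits
    required by piecewise smoothness. *)
Lemma field_cvg (F : set_system R) g t : Filter F -> I t ->
  within I (nbhs t) `<=` F -> (\forall u \near F, sigma u = g) ->
  f (sigma u) (y u) @[u --> F] --> f g (y t).
Proof.
move=> FF It IF sg.
have yt : y u @[u --> F] --> y t.
  apply: cvg_trans ((subspace_continuousP _ _).1 lipschitz_continuous_on t It).
  by move=> P /IF.
have fg : f g (y u) @[u --> F] --> f g (y t) by apply: continuous_cvg yt; exact: fc.
apply: cvg_trans fg => P; rewrite /= => Pg.
by apply: filterS2 sg Pg => u /= ->.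
Qed.

(** Left limits come from piecewise constancy: just before [t] there is an interval free of break
    points, cut off at 0. *)
Lemma signal_left_constant t : 0 < t -> exists g, \forall u \near t^'-, sigma u = g.
Proof.
move=> t0; have [[E [Efin Econst]] _] := sigma_signal.
have [d d0 dP] := locally_finite_isolated t Efin.
pose a := Num.max 0 (t - d).
have at_ : a < t by rewrite gt_max t0 ltrBlDr ltrDl.
have a0 : 0 <= a by rewrite le_max lexx.
have ad : t - d <= a by rewrite le_max lexx orbT.
exists (sigma ((a + t) / 2)); apply/near_leftP; exists (t - a).
  by rewrite subr_gt0.
move=> u; rewrite subKr => au ut; apply: (Econst a t a0).
- rewrite -subset0 => r [Er]; rewrite /= in_itv/= => /andP[ar rt].
  apply: (dP r) Er; first by rewrite (le_trans a0)// ltW.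
    by rewrite lt_eqF.
  by rewrite gtr0_norm ?subr_gt0//; lra.
- by rewrite au.
- by apply/andP; lra.
Qed.

Lemma limit_solution : solution f sigma I y.
Proof.
have yc := lipschitz_continuous_on.
split.
- exists +oo%E; split; first exact: ltry.
  by left; apply/seteqP; split=> t; rewrite /= in_itv/= andbT ?ltry//; case.
- split=> //; exists D, (fun t => f (sigma t) (y t)); split=> //.
  + by move=> t [_]; exact: yd.
  + apply/subspace_continuousP => t [It Dt].
    apply: field_cvg => //.
      by move=> P; rewrite /within /=; apply: filterS => u H [/H].
    have [d d0 dP] := sigma_const Dt; rewrite near_withinE.
    by apply/nbhs_normP; exists d => // u /dP[_ ->].
  + move=> t It; have t0 : 0 <= t by move: It; rewrite /= in_itv/= andbT.
    have IA (A : set R) : within I (nbhs t) `<=` within I (within A (nbhs t)).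
      by move=> P; rewrite /within /=; apply: filterS => u H _.
    split.
      exists (f (sigma t) (y t)); apply: field_cvg => //; first exact: IA.
      have /discrete_cvg st : sigma u @[u --> t^'+] --> sigma t by exact: sigma_signal.2.
      have {}st : \forall u \near t^'+, sigma u = sigma t by exact: st.
      rewrite near_withinE.
      by apply: filterS st => u /= ->.
    have [t0'|t0'] := ltP 0 t.
      have [g sg] := signal_left_constant t0'.
      exists (f g (y t)); apply: field_cvg => //; first exact: IA.
      rewrite near_withinE.
      by apply: filterS sg.
    (* At time 0 nothing of the domain lies to the left, so any vector is a limit. *)
    exists 0 => P _; apply/near_leftP; exists 1 => // u _ ut.
    by rewrite /= in_itv/= andbT leNgt (lt_le_trans ut).
move=> t [It st]; have t0 : 0 <= t by move: It; rewrite /= in_itv/= andbT.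
have t0' : 0 < t.
  by rewrite lt_neqAle t0 andbT eq_sym; apply/eqP => t0'; apply: st; left.
have /discrete_continuousP/nbhs_normP[d d0 dP] : {for t, continuous sigma}.
  by apply: contrapT => nc; apply: st; right.
have [d' d'0 d'P] := locally_finite_isolated t D_finite.
(* Here [t] may belong to [D]; its neighbours do not, and [sigma] is constant around it. *)
apply: (@derivative_extension _ _ _ _ _ _ _ (Num.min d d')) => //.
  by rewrite lt_min d0.
move=> r r0 rt; rewrite lt_min => /andP[rd rd'].
by rewrite -(dP r rd); apply: yd; apply: d'P => //; exact: ltW.
Qed.

(** Points of [D] are approached from the right, where times lie off [D] and the signal already
    equals [sigma t]; closedness of [chi (sigma t)] concludes. *)
Lemma limit_in_covering (chi : mode m -> set 'rV[R]_n) :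
  (forall g, closed (chi g)) -> (forall t, ~ D t -> chi (sigma t) (y t)) ->
  forall t, I t -> chi (sigma t) (y t).
Proof.
move=> chi_closed chiD t It; have t0 : 0 <= t by move: It; rewrite /= in_itv/= andbT.
have It' : within I (nbhs t) `<=` t^'+.
  move=> P; rewrite /at_right /within /=; apply: filterS => u H tu; apply: H.
  by rewrite in_itv/= andbT (le_trans t0)// ltW.
have yt : y u @[u --> t^'+] --> y t.
  apply: cvg_trans ((subspace_continuousP _ _).1 lipschitz_continuous_on t It).
  by move=> P /It'.
apply: (@closed_cvg _ _ _ (at_right_proper_filter t) y _ (chi_closed (sigma t)) _ _ yt).
have /discrete_cvg st : sigma u @[u --> t^'+] --> sigma t by exact: sigma_signal.2.
have {}st : \forall u \near t^'+, sigma u = sigma t by exact: st.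
have [d d0 dP] := locally_finite_isolated t D_finite.
have Dt : \forall u \near t^'+, ~ D u.
  apply/near_rightP; exists d => // u tu ud; apply: dP.
  - by rewrite (le_trans t0)// ltW.
  - by rewrite gt_eqF.
  - by rewrite distrC gtr0_norm ?subr_gt0// ltrBlDl.
by apply: filterS2 st Dt => u /= <-; exact: chiD.
Qed.
End LimitTrajectory.

(** * Maximality and the SC property *)

Lemma global_solution_maximal (R : realType) (n m : nat)
    (f : mode m -> 'rV[R]_n -> 'rV[R]_n) sigma x :
  solution f sigma `[0, +oo[%classic x ->
  maximal_solution f sigma `[0, +oo[%classic x.
Proof.
move=> xsol; split=> // J z [[T [_ JT]] _ _] IJ _.
(* A time domain contains no negative time, so nothing properly extends [[0, +oo[]. *)
apply/seteqP; split=> // t; rewrite /= in_itv/= andbT.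
by case: JT => -> [].
Qed.

Theorem propositionA1 (R : realType) (n m : nat)
    (f : mode m -> 'rV[R]_n -> 'rV[R]_n) (chi : mode m -> set 'rV[R]_n)
    (hf : forall g : mode m, continuous (f g))
    (hchi : closed_covering chi)
    (tauD : R) (N0 : nat) (htauD : 0 < tauD) (hN0 : (0 < N0)%N) :
  SC_property (covering_trajectories f chi `&` adt_trajectories f tauD N0).
Proof.
move=> X XF [M [M0 XM]].
have Xdom l : dom (X l) = `[0, +oo[%classic by have [] := XM l.
have Xadt l : average_dwell_time tauD N0 (signal (X l)) by have [_ []] := XF l.
have Xsol l : solution f (signal (X l)) `[0, +oo[%classic (curve (X l)).
  by rewrite -(Xdom l); have [[[_ []]]] := XF l.
have Xchi l t : 0 <= t -> chi (signal (X l) t) (curve (X l) t).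
  have [[_ H] _] := XF l => t0.
  by apply: H; rewrite Xdom /= in_itv/= t0.
have [L L_gt0 fL] := field_bound M hf; have L0 := ltW L_gt0.
have XL l := solution_lipschitz L0 fL (Xadt l) (Xsol l) (XM l).2.
have [k1 [sigma [D [k1mono sigma_adt Dfin sigmaD]]]] :=
  average_dwell_time_compact Xadt.
have [k2 [y [k2mono xy]]] := lipschitz_sequence_compact (x := fun l => curve (X (k1 l)))
  L0 (fun l => (XM (k1 l)).2) (fun l => XL (k1 l)).
(* Signals are extracted first, then curves; eventual agreement of the signals persists along the
   second subsequence. *)
pose k := k1 \o k2.
have yL := lipschitz_limit xy (fun l => XL (k l)).
have sigma_const t : ~ D t -> exists2 d : R, 0 < d &
    forall u, `|t - u| < d -> 0 <= u /\ sigma u = sigma t.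
  by move=> /sigmaD[d d0 [dP _]]; exists d.
have sigma_cvg t : ~ D t -> exists2 d : R, 0 < d &
    \forall l \near \oo, forall u, `|t - u| < d -> signal (X (k l)) u = sigma t.
  by move=> /sigmaD[d d0 [_ dP]]; exists d => //; exact: near_subseq dP.
have yd t : ~ D t -> derivative_on `[0, +oo[%classic y t (f (sigma t) (y t)).
  move=> Dt; have [d d0 [dP lP]] := sigmaD t Dt.
  apply: (limit_derivative L0 d0 (hf _) _ (fun l => Xsol (k l)) (fun l => XL (k l)) xy).
    by move=> u /dP[].
  exact: near_subseq lP.
have ysol := limit_solution hf L0 yL sigma_adt.1 Dfin sigma_const yd.
have ymax := global_solution_maximal ysol.
have ychi := limit_in_covering L0 yL sigma_adt.1 Dfin hchi.1.
exists k, (Trajectory `[0, +oo[%classic y sigma); split=> //.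
- by move=> i j ij; apply: k1mono; exact: k2mono.
- split; split; rewrite /maximal_trajectories //=.
  + by split=> //; exact: sigma_adt.1.
  + apply: ychi => t Dt; have [d d0 sc] := sigma_cvg t Dt.
    have t0 : 0 <= t.
      have [e e0 /(_ t)[]] := sigma_const t Dt; rewrite ?subrr ?normr0//.
    apply: (@closed_cvg _ _ _ _ _ _ (hchi.1 (sigma t)) _ _ (xy t t0)).
    by apply: filterS sc => l sc; rewrite -(sc t) ?subrr ?normr0//; exact: Xchi.
  + by split=> //; exact: sigma_adt.1.
- by move=> K cK K0; exact: lipschitz_cvg_compact L0 xy (fun l => XL (k l)) cK K0.
(* Signals converge off [D], whose nonnegative part is countable and hence null. *)
exists (D `&` `[0, +oo[); split.
- exact: countable_measurable (locally_finite_countable Dfin).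
- exact: countable_lebesgue_measure0 (locally_finite_countable Dfin).
move=> t /= nt; apply: contrapT => nD; apply: nt => t0.
apply/discrete_cvg; have [d d0] : exists2 d : R, 0 < d &
    \forall l \near \oo, forall u, `|t - u| < d -> signal (X (k l)) u = sigma t.
  by apply: sigma_cvg => Dt; apply: nD; split=> //; rewrite /= in_itv/= t0.
by apply: filterS => l; apply; rewrite subrr normr0.
Qed.
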